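(* Let $S$ be a non-exceptional left amenable semigroup of polynomials. Then $LIM(S)=RIM(S)$.
   Context: A semigroup of polynomials is a non-empty family of non-constant complex polynomials closed under composition, with composition as product. A polynomial $Q$ is exceptional if $\deg(Q)\le1$, or $Q$ is affinely conjugate to $z^n$ or to a Chebyshev polynomial. A semigroup of polynomials is non-exceptional if it contains a non-exceptional polynomial. $L_\infty(S)$ is the space of bounded complex functions on $S$ with supremum norm; $(r_s\phi)(t)=\phi(ts)$, $(l_s\phi)(t)=\phi(st)$. A mean is a positive continuous linear functional $M$ on $L_\infty(S)$ with $M(1)=1$. $RIM(S)$ (resp. $LIM(S)$) is the set of means invariant under all $r_s$ (resp. all $l_s$), $s\in S$. $S$ is left amenable if $LIM(S)\ne\emptyset$. *)

(* Defs.v *)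
From HB Require Import structures.
From mathcomp Require Import all_boot all_order all_algebra.
From mathcomp Require Import all_classical all_reals all_analysis.
From mathcomp Require Import complex.

Set Implicit Arguments.
Unset Strict Implicit.
Unset Printing Implicit Defensive.

Import Order.TTheory GRing.Theory Num.Theory.
Import numFieldNormedType.Exports.

Local Open Scope classical_set_scope.
Local Open Scope ring_scope.
Local Open Scope complex_scope.

Section Linf.
Context (R : realType) (T : Type).

Notation normc := ComplexField.Normc.normc.

Definition bounded_pred : {pred T -> R[i]^o} :=
  mem (bounded_fun : set (T -> R[i]^o)).

(* The bounded functions [T -> R[i]], made below into a normed module over
   [R[i]]; norms of such modules are [R[i]]-valued, whence the cast [_%:C] of
   the real-valued supremum norm. *)
Record Linf := MkLinf {
  Linf_fun :> T -> R[i]^o;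
  Linf_bounded : Linf_fun \in bounded_pred }.

HB.instance Definition _ := [isSub for Linf_fun].
HB.instance Definition _ := [Choice of Linf by <:].

Lemma bounded_predP (phi : T -> R[i]^o) :
  phi \in bounded_pred <-> exists M : R, forall t, normc (phi t) <= M.
Proof.
rewrite in_setE; split.
  rewrite /= /bounded_near => /pinfty_ex_gt0[M _ h]; exists (complex.Re M) => t.
  have : (normc (phi t))%:C <= M by exact: h.
  by rewrite lecE => /andP[_].
move=> [M h]; rewrite /= /bounded_near; near=> x => t _ /=.
apply: (@le_trans _ _ M%:C); last by near: x; apply: nbhs_pinfty_ge; rewrite complex_real.
by rewrite [X in X <= _](_ : _ = (normc (phi t))%:C)// lecR.
Unshelve. all: by end_near. Qed.

Lemma bounded_submod_closed : submod_closed bounded_pred.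
Proof.
split; first by apply/bounded_predP; exists 0 => t; rewrite ComplexField.Normc.normc0.
move=> a f g /bounded_predP[M hM] /bounded_predP[N hN].
apply/bounded_predP; exists (normc a * M + N) => t.
apply: (le_trans (le_normcD _ _)); apply: lerD => //.
rewrite [X in normc X](_ : _ = a * f t)// ComplexField.Normc.normcM.
by rewrite ler_wpM2l//; case: (a) => x y; rewrite sqrtr_ge0.
Qed.

HB.instance Definition _ :=
  GRing.isSubmodClosed.Build _ _ bounded_pred bounded_submod_closed.
HB.instance Definition _ := [SubChoice_isSubLmodule of Linf by <:].

Definition sup_norm (phi : Linf) : R :=
  sup (range (fun t => normc (phi t))).

Lemma normc_ge0 (z : R[i]) : 0 <= normc z.
Proof. by case: z => x y; rewrite sqrtr_ge0. Qed.

Lemma normc_le_sup (phi : Linf) t : normc (phi t) <= sup_norm phi.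
Proof.
apply: ub_le_sup; last by exists t.
by have /bounded_predP[M h] := Linf_bounded phi; exists M => _ [s _ <-].
Qed.

Lemma sup_norm_le (phi : Linf) (c : R) :
  0 <= c -> (forall t, normc (phi t) <= c) -> sup_norm phi <= c.
Proof.
move=> c0 h; rewrite /sup_norm.
have [->|ne] := eqVneq (range (fun t => normc (phi t))) set0.
  by rewrite sup0.
by apply: ge_sup; [exact/set0P|move=> _ [t _ <-]].
Qed.

Lemma sup_norm_ge0 (phi : Linf) : 0 <= sup_norm phi.
Proof.
rewrite /sup_norm.
have [->|/set0P[_ [t _ _]]] := eqVneq (range (fun t => normc (phi t))) set0.
  by rewrite sup0.
by apply: le_trans (normc_le_sup phi t); exact: normc_ge0.
Qed.

Lemma sup_normD (f g : Linf) :
  (sup_norm (f + g))%:C <= (sup_norm f)%:C + (sup_norm g)%:C.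
Proof.
rewrite -rmorphD lecR; apply: sup_norm_le => [|t].
  by rewrite addr_ge0 ?sup_norm_ge0.
apply: (le_trans (le_normcD _ _)).
by apply: lerD; exact: normc_le_sup.
Qed.

Lemma sup_normZ (a : R[i]) (f : Linf) :
  (sup_norm (a *: f))%:C = `|a| * (sup_norm f)%:C.
Proof.
have le b g : sup_norm (b *: g) <= normc b * sup_norm g.
  apply: sup_norm_le => [|t]; first by rewrite mulr_ge0 ?normc_ge0 ?sup_norm_ge0.
  rewrite [X in normc X](_ : _ = b * g t)// ComplexField.Normc.normcM.
  by rewrite ler_wpM2l ?normc_ge0 ?normc_le_sup.
rewrite [X in X * _](_ : _ = (normc a)%:C)// -rmorphM; congr (_%:C).
apply/eqP; rewrite eq_le le /=.
have [->|a0] := eqVneq a 0.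
  by rewrite ComplexField.Normc.normc0 mul0r sup_norm_ge0.
have na : 0 < normc a.
  rewrite lt_neqAle normc_ge0 andbT eq_sym.
  by apply: contra a0 => /eqP/ComplexField.Normc.eq0_normc ->.
rewrite -ler_pdivlMl// -ComplexField.Normc.normcV.
by apply: le_trans (le _ _); rewrite scalerA mulVf// scale1r.
Qed.

Lemma sup_norm_eq0 (f : Linf) : (sup_norm f)%:C = 0 -> f = 0.
Proof.
move=> [f0]; apply/val_inj/funext => t /=.
apply: ComplexField.Normc.eq0_normc; apply/eqP.
by rewrite eq_le normc_ge0 andbT -f0 normc_le_sup.
Qed.

HB.instance Definition _ := @Lmodule_isNormed.Build R[i] Linf
  (fun phi => (sup_norm phi)%:C) sup_normD sup_normZ sup_norm_eq0.

Lemma cst1_bounded : (fun=> 1 : R[i]^o) \in bounded_pred.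
Proof. by apply/bounded_predP; exists (normc 1). Qed.

Definition Linf1 : Linf := MkLinf cst1_bounded.

Lemma comp_bounded (f : T -> T) (phi : Linf) :
  (fun t => phi (f t)) \in bounded_pred.
Proof.
by have /bounded_predP[M h] := Linf_bounded phi; apply/bounded_predP; exists M.
Qed.

End Linf.

Section Means.
Context (R : realType) (S : semigroupType).
Notation L := (Linf R S).

Definition rtrans (s : S) (phi : L) : L :=
  MkLinf (comp_bounded (fun t => (t * s)%g) phi).

Definition ltrans (s : S) (phi : L) : L :=
  MkLinf (comp_bounded (fun t => (s * t)%g) phi).

(* In [R[i]], [0 <= z] means that [z] is real and nonnegative. *)
Definition positive_functional (M : {linear L -> R[i]^o}) :=
  forall phi : L, (forall t, 0 <= phi t) -> 0 <= M phi.

Definition is_mean (M : {linear L -> R[i]^o}) :=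
  [/\ continuous M, positive_functional M & M (Linf1 R S) = 1].

Definition LIM : set {linear L -> R[i]^o} :=
  [set M | is_mean M /\ forall s phi, M (ltrans s phi) = M phi].

Definition RIM : set {linear L -> R[i]^o} :=
  [set M | is_mean M /\ forall s phi, M (rtrans s phi) = M phi].

Definition left_amenable := LIM !=set0.

End Means.

Arguments LIM R S : clear implicits.
Arguments RIM R S : clear implicits.
Arguments left_amenable R S : clear implicits.

Section Polynomials.
Context (R : realType).
Notation C := R[i].

(* Chebyshev polynomials of the first kind, cos (n x) = T_n (cos x). *)
Fixpoint chebyshev (n : nat) : {poly C} :=
  match n with
  | 0 => 1
  | 1 => 'X
  | (m.+1 as k).+1 => 2%:R *: 'X * chebyshev k - chebyshev m
  end.

(* P = A^-1 \o Q \o A with A(z) = a z + b, a <> 0. *)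
Definition affine_conj (P Q : {poly C}) :=
  exists a b : C, a != 0 /\
    P = (a^-1 *: ('X - b%:P)) \Po (Q \Po (a *: 'X + b%:P)).

Definition exceptional (Q : {poly C}) :=
  (* [size] is the degree plus one *)
  [\/ (size Q <= 2)%N,
      exists n : nat, affine_conj Q 'X^n |
      exists n : nat, affine_conj Q (chebyshev n)].

Record poly_semigroup := PolySemigroup {
  psg_set :> set {poly C};
  psg_nonempty : psg_set !=set0;
  psg_nonconst : forall P, psg_set P -> (1 < size P)%N;
  psg_comp : forall P Q, psg_set P -> psg_set Q -> psg_set (P \Po Q) }.

Definition non_exceptional (S : poly_semigroup) :=
  exists2 P, psg_set S P & ~ exceptional P.

Definition psg_elt (S : poly_semigroup) : Type := {P | P \in psg_set S}.

HB.instance Definition _ (S : poly_semigroup) := Choice.on (psg_elt S).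

Section Product.
Variable S : poly_semigroup.

Lemma psg_mul_subproof (s t : psg_elt S) : val s \Po val t \in psg_set S.
Proof. by rewrite in_setE; apply: psg_comp; apply/set_mem/valP. Qed.

(* The product [s * t] is [s \o t], i.e. z |-> s (t z). *)
Definition psg_mul (s t : psg_elt S) : psg_elt S :=
  exist _ (val s \Po val t) (psg_mul_subproof s t).

Lemma psg_mulA : associative psg_mul.
Proof. by move=> s t u; apply/val_inj; rewrite /= comp_polyA. Qed.

HB.instance Definition _ := isSemigroup.Build (psg_elt S) psg_mulA.

End Product.

End Polynomials.

(* Main.v *)
Require Import Defs.
From mathcomp Require Import all_boot all_order all_algebra.
From mathcomp Require Import all_classical all_reals all_analysis.
From mathcomp Require Import complex.
From mathcomp Require Import zify.

(** The proof separates a combinatorial fact on means from an algebraic fact on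
polynomials; the degree is what links them.

Composition of polynomials is not commutative, but the degree of [s * t] is
that of [t * s]. Suppose that the number of elements of [S] of a given degree
is bounded, and let [l] list a fibre of the degree map of largest size. In a
right cancellative, left reversible semigroup (any two right ideals meet), the
translates [l * x] and [x * l] are again entire fibres. So the average of [phi]
over [l * x * s] equals its average over [l * s * x], and averaging over [l]
transforms left invariance of a mean into right invariance and conversely
([LIM_eq_RIM_of_bounded_fibres]).

Left amenability gives left reversibility, and composition is right
cancellative. The bound on the fibres rests on uniqueness of decompositions: if
[f \Po x = g \Po y] with [x] and [y] of the same degree, then [x] is an affine
map composed with [y] ([comp_poly_factor]). By reversibility, elements [t], [u]
of the same degree and any [P] in [S] satisfy [u * P * x = t * P * y] for some
[x], [y]; two uses of [comp_poly_factor] yield [t = u \Po sg] with [sg] affine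
and [sg \Po P = P \Po l] for an affine [l]. Such an [l] maps critical points
of [P] to critical points, hence is one of finitely many as soon as [P] has two critical
points ([finite_symmetries]). This holds for [P = s \Po s] unless [s] is
conjugate to a power ([two_critical_points]), so a non-exceptional [s] gives a
bound that depends on [s] only. *)

Set Implicit Arguments.
Unset Strict Implicit.
Unset Printing Implicit Defensive.

Import Order.TTheory GRing.Theory Num.Theory.
Local Open Scope classical_set_scope.
Local Open Scope ring_scope.
Local Open Scope complex_scope.

(** * Affine maps and decompositions of polynomials *)

Lemma size2_affine (F : nzRingType) (l : {poly F}) : size l = 2%N ->
  l = l`_1 *: 'X + (l`_0)%:P.
Proof.
move=> sl; apply/polyP => i; rewrite coefD coefZ coefX coefC.
case: i => [|[|i]] /=; rewrite ?mulr0 ?mulr1 ?add0r ?addr0//.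
by rewrite nth_default// sl.
Qed.

Lemma size_affine (F : nzRingType) (a b : F) : a != 0 ->
  size (a *: 'X + b%:P) = 2%N.
Proof.
by move=> a0; rewrite -mul_polyC size_MXaddC polyC_eq0 (negPf a0)/= size_polyC a0.
Qed.

Lemma comp_poly_injl (F : idomainType) (q : {poly F}) : (1 < size q)%N ->
  injective (fun p => p \Po q).
Proof.
move=> sq p p' /eqP; rewrite -subr_eq0 -comp_polyB comp_poly_eq0//.
by rewrite subr_eq0 => /eqP.
Qed.

(** With equal leading coefficients (after rescaling [y] to [r *: y]) the top
terms of both sides give [x ^+ k - (r *: y) ^+ k], which is [x - r *: y] times
a sum [W] of [k] terms of degree [(k - 1) m] with a common leading coefficient;
[k != 0] in the field, so [W] has that degree. The other terms of both sides
have degree at most [(k - 1) m], which forces [x - r *: y] to be constant. *)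
Lemma comp_poly_factor (F : numFieldType) (f g x y : {poly F}) :
  (1 < size f)%N -> (1 < size x)%N -> size x = size y ->
  f \Po x = g \Po y ->
  exists2 l : {poly F}, size l = 2%N & x = l \Po y.
Proof.
move=> sf sx sxy fxgy.
have sy : (1 < size y)%N by rewrite -sxy.
have sg : (size g).-1 = (size f).-1.
  have := congr1 (fun p : {poly F} => (size p).-1) fxgy.
  rewrite !size_comp_poly -sxy => /esym/eqP.
  by rewrite eqn_pmul2r ?ltn_predRL// => /eqP.
set k := (size f).-1 in sg; set m := (size x).-1.
have k0 : (0 < k)%N by rewrite ltn_predRL.
have x0 : x != 0 by rewrite -size_poly_gt0 (ltn_trans _ sx).
have y0 : y != 0 by rewrite -size_poly_gt0 (ltn_trans _ sy).
pose r := lead_coef x / lead_coef y.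
have r0 : r != 0 by rewrite mulf_neq0 ?invr_eq0 ?lead_coef_eq0.
have lry : lead_coef (r *: y) = lead_coef x.
  by rewrite lead_coefZ divfK ?lead_coef_eq0.
have sry : size (r *: y) = size x by rewrite size_scale.
have split_lead (p : {poly F}) : (size p).-1 = k ->
    exists2 q : {poly F}, (size q <= k)%N & p = lead_coef p *: 'X^k + q.
  move=> sp; exists (p - lead_coef p *: 'X^k); last by rewrite addrC subrK.
  apply/leq_sizeP => j kj; rewrite coefB coefZ coefXn.
  have [->|jk] := eqVneq j k; first by rewrite mulr1 lead_coefE sp subrr.
  rewrite mulr0 subr0 nth_default//.
  by rewrite (leq_trans (leqSpred _))// sp ltn_neqAle eq_sym jk.
have [f0 sf0 fE] := split_lead f erefl.
have [g0 sg0 gE] := split_lead g sg.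
have lfg : lead_coef g = lead_coef f * r ^+ k.
  have := congr1 lead_coef fxgy; rewrite !lead_coef_comp// sg -/k -{1}lry.
  rewrite lead_coefZ exprMn mulrA => /(mulIf _) ->//.
  by rewrite expf_neq0 ?lead_coef_eq0.
pose W := \sum_(i < k) x ^+ (k.-1 - i) * (r *: y) ^+ i.
have low (q z : {poly F}) : size z = size x -> (size q <= k)%N ->
    (size (q \Po z) <= (k.-1 * m).+1)%N.
  move=> sz sq; apply: (leq_trans (size_comp_poly_leq _ _)).
  rewrite sz ltnS leq_mul2r; apply/orP; right.
  by rewrite -!subn1 leq_sub2r.
have keyE : lead_coef f *: ((x - r *: y) * W) = (g0 \Po y) - (f0 \Po x).
  rewrite -subrXX scalerBr exprZn scalerA -lfg.
  have := fxgy; rewrite {1}fE {1}gE !comp_polyD !comp_polyZ !comp_Xn_poly.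
  by move=> h; apply/eqP; rewrite subr_eq addrAC eq_sym subr_eq h addrC.
have sW : (k.-1 * m < size W)%N.
  rewrite ltnNge; apply/negP => /leq_sizeP/(_ _ (leqnn _)).
  rewrite coef_sum (eq_bigr (fun=> lead_coef x ^+ k.-1)) => [|i _].
    rewrite sumr_const card_ord => /eqP; rewrite mulrn_eq0 gtn_eqF//=.
    by apply/negP; rewrite expf_neq0 ?lead_coef_eq0.
  set u := x ^+ _; set v := _ ^+ i.
  have suv : (size (u * v)).-1 = (k.-1 * m)%N.
    have u0 : (0 < size u)%N by rewrite size_poly_gt0 expf_neq0.
    have v0 : (0 < size v)%N by rewrite size_poly_gt0 expf_neq0// scaler_eq0 negb_or r0.
    rewrite size_mul -?size_poly_gt0//.
    have su : (size u).-1 = (m * (k.-1 - i))%N by exact: size_exp.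
    have sv : (size v).-1 = (m * i)%N by rewrite size_exp sry.
    have ik : (i <= k.-1)%N by rewrite -ltnS prednK.
    by rewrite -(prednK u0) -(prednK v0) su sv addSn addnS/= -mulnDr subnK// mulnC.
  rewrite -suv -lead_coefE lead_coefM !lead_coef_exp lry -exprD subnK//.
  by rewrite -ltnS prednK.
have d1 : (size (x - r *: y)%R <= 1)%N.
  have [->|d0] := eqVneq (x - r *: y) 0; first by rewrite size_poly0.
  have W0 : W != 0 by rewrite -size_poly_gt0 (leq_trans _ sW).
  have : (size (lead_coef f *: ((x - r *: y) * W))%R <= (k.-1 * m).+1)%N.
    rewrite keyE (leq_trans (size_polyD _ _))// size_polyN geq_max !low//.
  rewrite size_scale; last first.
    by rewrite lead_coef_eq0 -size_poly_gt0 (ltn_trans _ sf).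
  by rewrite size_mul//; move: sW; move: (size W) (size (x - _)%R) (k.-1 * m)%N => *; lia.
exists (r *: 'X + ((x - r *: y)`_0)%:P); first exact: size_affine.
by rewrite comp_polyD comp_polyZ comp_polyX comp_polyC -size1_polyC// addrC subrK.
Qed.

(** * Critical points and affine symmetries *)

Lemma size_deriv_num (F : numDomainType) (p : {poly F}) :
  size p^`() = (size p).-1.
Proof.
have [sp|sp] := leqP (size p) 1.
  by rewrite (size1_polyC sp) derivC size_poly0 size_polyC; case: eqP.
have p0 : p != 0 by rewrite -size_poly_gt0 (ltn_trans _ sp).
have : p^`()`_(size p).-2 != 0.
  rewrite coef_deriv prednK ?ltn_predRL// mulrn_eq0 -lead_coefE lead_coef_eq0.
  by rewrite (negPf p0) orbF -lt0n ltn_predRL.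
have := lt_size_deriv p0.
have [le|] := leqP (size p^`()) (size p).-2; first by rewrite nth_default// eqxx.
by case: (size p) sp => [|[|n]]//= _; lia.
Qed.

Lemma poly_single_root (F : closedFieldType) (p : {poly F}) (z : F) :
  (forall w, root p w -> w = z) ->
  p = lead_coef p *: ('X - z%:P) ^+ (size p).-1.
Proof.
have [r pE] := closed_field_poly_normal p.
have [->|p0] := eqVneq p 0; first by rewrite lead_coef0 !scale0r.
have lp : lead_coef p != 0 by rewrite lead_coef_eq0.
move=> h; rewrite {1}pE; congr (_ *: _).
have -> : (size p).-1 = size r by rewrite pE size_scale// size_prod_XsubC.
rewrite big_seq (eq_bigr (fun=> 'X - z%:P)) -?big_seq.
  by rewrite big_const_seq count_predT; elim: (size r) => //= n ->; rewrite exprS.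
move=> w wr; rewrite (h w)// pE rootZ//.
by rewrite root_prod_XsubC.
Qed.

(** Let [z] be a critical point of [s]. If [z] is the only critical point of
[s \Po s] then it is the only preimage of [z] under [s], so [s - z] is a
multiple of a power of ['X - z]. *)
Lemma two_critical_points (F : numClosedFieldType) (s : {poly F}) :
  (2 < size s)%N ->
  ~ (exists c z, c != 0 /\
       s = c *: ('X - z%:P) ^+ (size s).-1 + z%:P) ->
  exists z w, [/\ z != w, root (s \Po s)^`() z & root (s \Po s)^`() w].
Proof.
move=> ss sP.
have /closed_rootP[z sz] : size s^`() != 1%N.
  by rewrite size_deriv_num; case: (size s) ss => [|[|[]]].
have rE w : root (s \Po s)^`() w = root s^`() s.[w] || root s^`() w.
  by rewrite deriv_comp /root hornerM horner_comp mulf_eq0.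
have [[w [zw rw]]|nw] := pselect (exists w, z != w /\ root (s \Po s)^`() w).
  by exists z, w; split => //; rewrite rE sz orbT.
have {}nw w : root (s \Po s)^`() w -> w = z.
  by move=> rw; have [//|wz] := eqVneq w z; case: nw; exists w; rewrite eq_sym.
case: sP.
have ssz : size (s - z%:P) = size s.
  rewrite size_polyDl// size_polyN (leq_ltn_trans (size_polyC_leq1 _))//.
  exact: ltn_trans ss.
exists (lead_coef (s - z%:P)), z; split.
  by rewrite lead_coef_eq0 -size_poly_gt0 ssz (ltn_trans _ ss).
have := @poly_single_root F (s - z%:P) z; rewrite ssz => <-; first by rewrite subrK.
move=> w; rewrite /root !hornerE subr_eq0 => /eqP swz; apply: nw.
by rewrite rE swz sz.
Qed.

(** Differentiating [sg \Po P = P \Po l] shows that [l] maps critical points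
of [P] to critical points. An affine map is determined by its values at two
points, which leaves finitely many [l], and [l] determines [sg]. *)
Lemma finite_symmetries (F : numClosedFieldType) (P : {poly F}) (z w : F) :
  z != w ->
  root P^`() z -> root P^`() w -> (1 < size P)%N ->
  exists L : seq {poly F}, forall sg l : {poly F},
    size sg = 2%N -> size l = 2%N -> sg \Po P = P \Po l -> sg \in L.
Proof.
move=> zw rz rw sP.
have [r dPE] := closed_field_poly_normal P^`().
(* [u.1] and [u.2] are the values of [l] at [z] and [w]; [A u] and [B u] are
   the resulting slope and constant term. *)
pose A (u : F * F) := (u.1 - u.2) / (z - w).
pose B u := u.1 - A u * z.
exists [seq A u ^+ (size P).-1 *: 'X +
     (P.[B u] - A u ^+ (size P).-1 * P.[0])%:P | u <- [seq (u, v) | u <- r, v <- r]].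
move=> sg l ssg sl h.
have lE := size2_affine sl; have sgE := size2_affine ssg.
set a := l`_1 in lE; set b := l`_0 in lE; set c := sg`_1 in sgE; set e := sg`_0 in sgE.
have a0 : a != 0 by have := @lead_coef_eq0 _ l; rewrite lead_coefE sl -size_poly_eq0 sl => ->.
have P0 : P != 0 by rewrite -size_poly_gt0 (ltn_trans _ sP).
have cE : c = a ^+ (size P).-1.
  have := congr1 lead_coef h; rewrite !lead_coef_comp ?sl//.
  rewrite (lead_coefE sg) (lead_coefE l) ssg sl/= expr1 mulrC => /mulfI; apply.
  by rewrite lead_coef_eq0.
have eE : e = P.[b] - c * P.[0].
  have := congr1 (fun p => p.[0]) h; rewrite /= !horner_comp lE sgE !hornerE => <-.
  by rewrite addrC addKr.
have crit x : root P^`() x -> a * x + b \in r.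
  move=> rx; have lP : lead_coef P^`() != 0.
    by rewrite lead_coef_eq0 -size_poly_gt0 size_deriv_num ltn_predRL.
  rewrite -root_prod_XsubC -(rootZ _ _ lP) -dPE.
  have := congr1 (fun p => p^`().[x]) h.
  rewrite /= !deriv_comp !hornerM (eqP rx) mulr0 !horner_comp lE.
  rewrite derivD derivZ derivX derivC addr0 alg_polyC !hornerE => /esym/eqP.
  by rewrite mulf_eq0 (negPf a0) orbF.
apply/mapP; exists (a * z + b, a * w + b).
  by apply/allpairsP; exists (a * z + b, a * w + b); split; rewrite /= ?crit.
have AE : A (a * z + b, a * w + b) = a.
  by rewrite /A/= opprD addrACA subrr addr0 -mulrBr mulfK// subr_eq0.
have BE : B (a * z + b, a * w + b) = b by rewrite /B AE/= addrC addKr.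
by rewrite AE BE -cE -eE.
Qed.

(** * Means on a semigroup with a degree map *)

(** The indicator of the right ideal [s * S] becomes 1 after left translation by
[s], so it has mean 1; two disjoint right ideals would have total mean 2. *)
Lemma left_amenable_reversible (R : realType) (S : semigroupType) :
  left_amenable R S -> forall s t : S, exists x y, (s * x = t * y)%g.
Proof.
move=> [M [[_ Mpos M1] Minv]] s t; apply: contrapT => nst.
pose ind (u : S) (x : S) : R[i]^o := if `[< exists v, x = (u * v)%g >] then 1 else 0.
have ind_bd u : ind u \in @bounded_pred R S.
  apply/bounded_predP; exists 1 => x; rewrite /ind; case: ifP => _.
    by rewrite ComplexField.Normc.normc1.
  by rewrite ComplexField.Normc.normc0 ler01.
have M_ind u : M (MkLinf (ind_bd u)) = 1.
  rewrite -(Minv u) -M1; congr (M _); apply/val_inj/funext => x /=.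
  by rewrite /ind asboolT//; exists x.
have : 0 <= M (Linf1 R S - MkLinf (ind_bd s) - MkLinf (ind_bd t)).
  apply: Mpos => x; rewrite [X in 0 <= X](_ : _ = 1 - ind s x - ind t x)// /ind.
  case: asboolP => [[v xv]|_]; case: asboolP => [[w xw]|_].
  - by case: nst; exists v, w; rewrite -xv.
  - by rewrite subrr subr0.
  - by rewrite subr0 subrr.
  - by rewrite !subr0 ler01.
by rewrite !linearB/= M1 !M_ind subrr sub0r oppr_ge0 ler10.
Qed.

Lemma Linf_sumE (R : realType) (S : Type) (I : Type) (r : seq I)
    (f : I -> Linf R S) x : (\sum_(i <- r) f i) x = \sum_(i <- r) f i x.
Proof. by elim/big_rec2: _ => // i y1 y2 _ <-. Qed.

Section Fibres.
Context (S : semigroupType) (d : S -> nat).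
Context (dM : {morph d : x y / (x * y)%g >-> (x * y)%N}).
Context (d_gt0 : forall x, (0 < d x)%N).
Context (rcancel : forall w : S, injective (fun x => (x * w)%g)).
Context (lrev : forall s t : S, exists x y, (s * x = t * y)%g).

(** The list need not contain all the elements of degree [m]. *)
Definition fibre_list (m : nat) (l : seq S) :=
  uniq l && all (fun x => d x == m) l.

Context (K : nat).
Context (fibre_le : forall m l, fibre_list m l -> (size l <= K)%N).

(** As [K] bounds the size of all the fibres, such a list exhausts its fibre. *)
Definition maximal_fibre m l := fibre_list m l && (size l == K).

Lemma maximal_fibre_mem m l x : maximal_fibre m l -> d x = m -> x \in l.
Proof.
move=> /andP[/andP[ul al] /eqP sl] dx.
apply: contraT => xl.
have /fibre_le : fibre_list m (x :: l) by rewrite /fibre_list/= xl ul dx eqxx.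
by rewrite /= sl ltnn.
Qed.

Lemma maximal_fibre_perm m l l' :
  maximal_fibre m l -> maximal_fibre m l' -> perm_eq l l'.
Proof.
move=> ml ml'; have /andP[/andP[ul /allP al] _] := ml.
have /andP[/andP[ul' /allP al'] _] := ml'.
apply: uniq_perm => // x; apply/idP/idP => xl.
  by apply: (maximal_fibre_mem ml'); apply/eqP/al.
by apply: (maximal_fibre_mem ml); apply/eqP/al'.
Qed.

(** Right translation is injective, so it keeps the extremal size, and a list of
that size is an entire fibre. *)
Lemma maximal_fibre_mulr m l s :
  maximal_fibre m l -> maximal_fibre (m * d s)%N [seq (x * s)%g | x <- l].
Proof.
move=> /andP[/andP[ul /allP al] sl]; rewrite /maximal_fibre /fibre_list size_map sl andbT.
rewrite map_inj_uniq ?ul; last exact: rcancel.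
by apply/allP => _ /mapP[x /al/eqP dx ->]; rewrite dM dx.
Qed.

(** Left translation need not be injective on [S]; on a largest fibre [l] it
is, because it maps [l] onto the fibre of degree [d s * m]. That fibre is
[l * s] by the previous lemma; for [z] in it, choose a common right multiple
[z * u = s * v]: then [v] has the degree of [l * u], so [v = x * u] with [x]
in [l], and [u] cancels in [z * u = s * x * u]. *)
Lemma maximal_fibre_mull m l s :
  maximal_fibre m l -> maximal_fibre (d s * m)%N [seq (s * x)%g | x <- l].
Proof.
move=> ml; have /andP[/andP[ul1 /allP al1] /eqP sl1] := maximal_fibre_mulr s ml.
have /andP[/andP[ul /allP al] /eqP sl] := ml.
rewrite /maximal_fibre /fibre_list size_map sl eqxx andbT; apply/andP; split; last first.
  by apply/allP => _ /mapP[x /al/eqP dx ->]; rewrite dM dx.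
apply: (leq_size_uniq ul1); last by rewrite !size_map.
move=> z zl; have [u [v zusv]] := lrev z s.
have dz : d z = (m * d s)%N by apply/eqP/al1.
have dv : d v = (m * d u)%N.
  have /eqP := congr1 d zusv; rewrite !dM dz mulnAC -mulnC eqn_pmul2l//.
  by move=> /eqP.
have /mapP[x xl vE] := maximal_fibre_mem (maximal_fibre_mulr u ml) dv.
apply/mapP; exists x => //; apply: (rcancel (w := u)).
by rewrite zusv vE mulgA.
Qed.

(** Averaging over a maximal fibre [l] turns left translations into right ones.
If [M] is left invariant, [#|l| * M (r_s phi)] is the mean of
[x |-> \sum_(w <- l) phi (w * x * s)]. As [w] runs over [l], both [w * x * s]
and [w * s * x] run over the fibre of the same degree, so this sum is
[\sum_(w <- l) phi (w * s * x)], whose mean is [#|l| * M phi]. The argument for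
right invariant [M] is symmetric, with [s * x * w] and [x * s * w]. *)
Lemma LIM_eq_RIM_of_maximal_fibre (R : realType) (m : nat) (l : seq S) :
  (0 < K)%N -> maximal_fibre m l -> LIM R S = RIM R S.
Proof.
move=> K0 ml.
have sl : size l = K by case/andP: ml => _ /eqP.
(* [M phi] and [M psi] are recovered as means of sums over [l], so equality of
   the sums suffices. *)
have avg (M : {linear Linf R S -> R[i]^o}) phi psi (f g : S -> Linf R S) :
    (forall w, M (f w) = M phi) -> (forall w, M (g w) = M psi) ->
    (forall x, \sum_(w <- l) f w x = \sum_(w <- l) g w x) -> M phi = M psi.
  move=> Mf Mg fg.
  have : M (\sum_(w <- l) f w) = M (\sum_(w <- l) g w).
    by congr (M _); apply/val_inj/funext => x /=; rewrite !Linf_sumE.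
  rewrite !linear_sum/= (eq_bigr _ (fun w _ => Mf w)) (eq_bigr _ (fun w _ => Mg w)).
  rewrite !big_const_seq !count_predT sl !iter_addr_0 => /eqP.
  by rewrite -subr_eq0 -mulrnBl mulrn_eq0 gtn_eqF//= subr_eq0 => /eqP.
have reindex (phi : Linf R S) m' l1 l2 :
    maximal_fibre m' l1 -> maximal_fibre m' l2 ->
    \sum_(w <- l1) phi w = \sum_(w <- l2) phi w.
  by move=> h1 h2; apply: perm_big; apply: maximal_fibre_perm h1 h2.
rewrite eqEsubset; split => M [Mm Minv]; split => // s phi.
- apply: (avg M _ _ (fun w => ltrans w (rtrans s phi))
    (fun w => ltrans (w * s)%g phi)).
  + by move=> w; rewrite Minv.
  + by move=> w; rewrite Minv.
  + move=> x /=.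
    have h1 := maximal_fibre_mulr s (maximal_fibre_mulr x ml).
    have h2 := maximal_fibre_mulr x (maximal_fibre_mulr s ml).
    rewrite mulnAC in h2; rewrite -!map_comp in h1 h2.
    by have := reindex phi _ _ _ h1 h2; rewrite !big_map.
- apply: (avg M _ _ (fun w => rtrans w (ltrans s phi))
    (fun w => rtrans (s * w)%g phi)).
  + by move=> w; rewrite Minv.
  + by move=> w; rewrite Minv.
  + move=> x /=.
    have h1 := maximal_fibre_mull s (maximal_fibre_mull x ml).
    have h2 := maximal_fibre_mull x (maximal_fibre_mull s ml).
    rewrite mulnCA in h2; rewrite -!map_comp in h1 h2.
    by have := reindex phi _ _ _ h1 h2; rewrite !big_map.
Qed.

End Fibres.

Theorem LIM_eq_RIM_of_bounded_fibres (R : realType) (S : semigroupType)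
    (d : S -> nat) (B : nat) (s0 : S) :
  {morph d : x y / (x * y)%g >-> (x * y)%N} ->
  (forall x, (0 < d x)%N) ->
  (forall w : S, injective (fun x => (x * w)%g)) ->
  (forall s t : S, exists x y, (s * x = t * y)%g) ->
  (forall m l, fibre_list d m l -> (size l <= B)%N) ->
  LIM R S = RIM R S.
Proof.
move=> dM d0 rcancel lrev fibreB.
pose P k := `[< exists m l, fibre_list d m l /\ size l = k >].
have P1 : P 1%N by apply/asboolP; exists (d s0), [:: s0]; rewrite /fibre_list/= eqxx.
have PB k : P k -> (k <= B)%N by move=> /asboolP[m [l [ml <-]]]; exact: fibreB ml.
have [K /asboolP[m [l [ml sl]]] Kmax] :=
  ex_maxnP (ex_intro (fun k => is_true (P k)) _ P1) PB.
apply: (@LIM_eq_RIM_of_maximal_fibre S d dM d0 rcancel lrev K _ R m l).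
- by move=> m' l' ml'; apply: Kmax; apply/asboolP; exists m', l'.
- exact: Kmax.
- by rewrite /maximal_fibre ml sl eqxx.
Qed.

(** * Semigroups of polynomials *)

(** The conjugating map sends [z] to 0; its slope [a] must satisfy
[a ^+ n.-1 = c]. *)
Lemma affine_conj_power (R : realType) (n : nat) (c z : R[i]) : (1 < n)%N -> c != 0 ->
  affine_conj (c *: ('X - z%:P) ^+ n + z%:P) 'X^n.
Proof.
case: n => [|[|n]]// _ c0; pose a := (n.+1).-root c.
have an : a ^+ n.+1 = c by exact: rootCK.
have a0 : a != 0 by rewrite rootC_eq0.
exists a, (- (a * z)); split => //.
have -> : a *: 'X + (- (a * z))%:P = a *: ('X - z%:P).
  by rewrite scalerBr -!mul_polyC -polyCM polyCN.
rewrite comp_Xn_poly exprZn comp_polyZ comp_polyB comp_polyX comp_polyC.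
rewrite polyCN opprK scalerDr scalerA (exprS a) mulKf// an; congr (_ + _).
by rewrite -mul_polyC -polyCM mulKf.
Qed.

Lemma psg_size (R : realType) (S : poly_semigroup R) (t : psg_elt S) :
  (1 < size (val t))%N.
Proof. by apply: (@psg_nonconst R S); apply/set_mem/(valP t). Qed.

Lemma psg_rcancel (R : realType) (S : poly_semigroup R) (w : psg_elt S) :
  injective (fun x => (x * w)%g).
Proof.
by move=> x y /(congr1 val)/= /(comp_poly_injl (psg_size w))/val_inj.
Qed.

(** Apply reversibility to [u * P] and [t * P], where [P = s * s] with [s]
non-exceptional: [u \Po P \Po x = t \Po P \Po y] with [x] and [y] of the same
degree. Hence [x = l \Po y], so [u \Po (P \Po l) = t \Po P]; and then
[P \Po l = sg \Po P], so [t = u \Po sg] where [sg] is one of the finitely many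
affine symmetries of [P]. *)
Lemma finite_ratios (R : realType) (S : poly_semigroup R) :
  (forall s t : psg_elt S, exists x y, (s * x = t * y)%g) ->
  non_exceptional S ->
  exists L : seq {poly R[i]}, forall t u : psg_elt S,
    size (val t) = size (val u) ->
    exists2 sg, sg \in L & val t = val u \Po sg.
Proof.
move=> lrev [s Ss s_ne].
have ss : (2 < size s)%N by rewrite ltnNge; apply/negP => ss; apply: s_ne; apply: Or31.
have [|z [w [zw rz rw]]] := two_critical_points ss.
  move=> [c [z [c0 sE]]]; apply: s_ne; apply: Or32; exists (size s).-1.
  have : (1 < (size s).-1)%N by rewrite ltn_predRL.
  by move: (size s).-1 sE => n -> n1; exact: affine_conj_power.
pose s' : psg_elt S := exist _ s (mem_set Ss).
pose P := (s' * s')%g; have sP := psg_size P.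
have [L hL] := finite_symmetries zw rz rw sP.
exists L => t u tu.
have [x [y /(congr1 val)/= xy]] := lrev (u * P)%g (t * P)%g.
have size_eq (p q : {poly R[i]}) : (size p).-1 = (size q).-1 -> (1 < size p)%N ->
    (1 < size q)%N -> size p = size q by lia.
have xy_size : size (val x) = size (val y).
  apply: size_eq; rewrite ?psg_size//.
  have := congr1 (fun p : {poly _} => (size p).-1) xy; rewrite !size_comp_poly tu => /eqP.
  rewrite eqn_pmul2l => [/eqP//|].
  by rewrite !muln_gt0 !ltn_predRL psg_size ltnW.
have [l sl xE] := comp_poly_factor (psg_size (u * P)%g) (psg_size x) xy_size xy.
have uPl : val u \Po (val P \Po l) = val t \Po val P.
  apply: (comp_poly_injl (psg_size y)).
  by rewrite -xy xE /= !comp_polyA.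
have sPl : size (val P \Po l) = size (val P).
  apply: size_eq => //; first by rewrite size_comp_poly sl muln1.
  by rewrite -ltn_predRL size_comp_poly sl muln1 ltn_predRL.
have [|sg ssg PlE] := comp_poly_factor (psg_size u) _ sPl uPl; first by rewrite sPl.
exists sg; first by apply: (hL sg l).
by apply: (comp_poly_injl sP); rewrite -uPl PlE comp_polyA.
Qed.

Theorem theorem7 (R : realType) (S : poly_semigroup R) :
  non_exceptional S ->
  left_amenable R (psg_elt S) ->
  LIM R (psg_elt S) = RIM R (psg_elt S).
Proof.
move=> neS laS; have lrev := left_amenable_reversible laS.
have [L hL] := finite_ratios lrev neS.
have [s Ss _] := neS; pose s0 : psg_elt S := exist _ s (mem_set Ss).
pose d (t : psg_elt S) := (size (val t)).-1.
apply: (@LIM_eq_RIM_of_bounded_fibres R _ d (size L) s0) => //.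
- by move=> x y; exact: size_comp_poly.
- by move=> x; rewrite ltn_predRL psg_size.
- exact: psg_rcancel.
move=> m [//|u l] /andP[ul /allP al].
pose f (t : psg_elt S) : {poly R[i]} := val t.
rewrite -(size_map f) -(size_map (fun sg => f u \Po sg) L).
apply: uniq_leq_size; first by rewrite map_inj_uniq//; exact: val_inj.
move=> _ /mapP[t tl ->].
have tu : size (f t) = size (f u).
  apply: (succn_inj); rewrite -(prednK (ltnW (psg_size t))) -(prednK (ltnW (psg_size u))).
  by rewrite [_.-1](eqP (al _ tl)) [_.-1](eqP (al u (mem_head _ _))).
have [sg Lsg tE] := hL _ _ tu.
by apply/mapP; exists sg.
Qed.
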